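(* Let $S \in \mathbb{C}^{3}\otimes \mathbb{C}^{4}\otimes \mathbb{C}^{4}$ be a concise $(3,3,3)$-compressible tensor. Then $S$ is an honest partial degeneration of the $2\times 2$ matrix multiplication tensor $\langle 2,2,2 \rangle$; that is, $\langle 2,2,2\rangle$ partially degenerates to $S$, but $\langle 2,2,2\rangle$ does not restrict to $S$.
   Context: All vector spaces are finite-dimensional over $\mathbb{C}$. For tensors $T \in U_1 \otimes U_2 \otimes U_3$ and $S \in V_1\otimes V_2\otimes V_3$: - $T$ restricts to $S$ ($T\geq S$) if there are linear maps $A_i: U_i\to V_i$ ($i=1,2,3$) with $S=(A_1\otimes A_2\otimes A_3)T$. - $T$ partially degenerates to $S$ if there are a linear map $A_1:U_1\to V_1$ (constant) and linear maps $A_2(\epsilon):U_2\to V_2$, $A_3(\epsilon):U_3\to V_3$ with entries in $\mathbb{C}[\epsilon]$, natural numbers $d,e\ge 0$ and tensors $S_1,\dots,S_e \in V_1\otimes V_2\otimes V_3$ such that $(A_1\otimes A_2(\epsilon)\otimes A_3(\epsilon))T=\epsilon^d S+\epsilon^{d+1}S_1+\dots+\epsilon^{d+e}S_e$. It is an honest partial degeneration if moreover $T$ does not restrict to $S$. A tensor $T\in U_1\otimes U_2\otimes U_3$ is concise if its three flattening maps $U_1^*\to U_2\otimes U_3$, $U_2^*\to U_1\otimes U_3$, $U_3^*\to U_1\otimes U_2$ are injective. It is $(a_1,a_2,a_3)$-compressible if there are linear maps $A_i:U_i\to U_i$ of rank $a_i$ with $(A_1\otimes A_2\otimes A_3)T=0$.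 The matrix multiplication tensor is $\langle m,n,p \rangle = \sum_{i=1}^m\sum_{j=1}^n\sum_{k=1}^p (e_i \otimes e_j) \otimes (e_j \otimes e_k) \otimes (e_k \otimes e_i) \in (\mathbb{C}^m \otimes \mathbb{C}^n) \otimes (\mathbb{C}^n \otimes \mathbb{C}^p) \otimes (\mathbb{C}^p \otimes \mathbb{C}^m)$. *)

(* Defs.v *)
From HB Require Import structures.
From mathcomp Require Import all_boot all_order all_algebra.
From mathcomp Require Import reals.
From mathcomp Require Export complex.

Set Implicit Arguments.
Unset Strict Implicit.
Unset Printing Implicit Defensive.

Import GRing.Theory.
Local Open Scope ring_scope.

(* F^a (x) F^b (x) F^c in coordinates: the entry at (i, j, k) is the
   coefficient of e_i (x) e_j (x) e_k. *)
Notation tensor F a b c := {ffun 'I_a * 'I_b * 'I_c -> F}.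

Definition pure_tensor (F : pzRingType) (a b c : nat)
    (u : 'cV[F]_a) (v : 'cV[F]_b) (w : 'cV[F]_c) : tensor F a b c :=
  [ffun x => u x.1.1 0 * v x.1.2 0 * w x.2 0].

(* (A (x) B (x) C) T, where a linear map F^a -> F^a' is given by its matrix in
   'M_(a', a), acting on column vectors. *)
Definition tensor_act (F : pzRingType) (a b c a' b' c' : nat)
    (A : 'M[F]_(a', a)) (B : 'M[F]_(b', b)) (C : 'M[F]_(c', c))
    (T : tensor F a b c) : tensor F a' b' c' :=
  \sum_i \sum_j \sum_k
    [ffun x => T (i, j, k) * (A x.1.1 i * B x.1.2 j * C x.2 k)].

Definition tensor_polyC (F : nzRingType) (a b c : nat) (T : tensor F a b c) :
    tensor {poly F} a b c :=
  [ffun x => (T x)%:P].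

Definition restricts_to (F : fieldType) (a b c a' b' c' : nat)
    (T : tensor F a b c) (S : tensor F a' b' c') : Prop :=
  exists (A1 : 'M[F]_(a', a)) (A2 : 'M[F]_(b', b)) (A3 : 'M[F]_(c', c)),
    S = tensor_act A1 A2 A3 T.

(* The variable epsilon is 'X; the tensor S_(s + 1) of the expansion is Ss s. *)
Definition partially_degenerates_to (F : fieldType) (a b c a' b' c' : nat)
    (T : tensor F a b c) (S : tensor F a' b' c') : Prop :=
  exists (A1 : 'M[F]_(a', a)) (A2 : 'M[{poly F}]_(b', b))
         (A3 : 'M[{poly F}]_(c', c)) (d e : nat)
         (Ss : 'I_e -> tensor F a' b' c'),
    tensor_act (map_mx polyC A1) A2 A3 (tensor_polyC T) =
    [ffun x => 'X^d * (S x)%:P + \sum_(s < e) 'X^(d + s.+1) * (Ss s x)%:P].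

Definition honest_partial_degeneration (F : fieldType) (a b c a' b' c' : nat)
    (T : tensor F a b c) (S : tensor F a' b' c') : Prop :=
  partially_degenerates_to T S /\ ~ restricts_to T S.

(* The flattening maps; a linear form on F^a is the row vector of its values
   on the basis, and F^b (x) F^c is identified with 'M_(b, c). *)
Definition flattening1 (F : fieldType) (a b c : nat) (T : tensor F a b c)
    (phi : 'rV[F]_a) : 'M[F]_(b, c) :=
  \matrix_(j, k) \sum_i phi 0 i * T (i, j, k).

Definition flattening2 (F : fieldType) (a b c : nat) (T : tensor F a b c)
    (phi : 'rV[F]_b) : 'M[F]_(a, c) :=
  \matrix_(i, k) \sum_j phi 0 j * T (i, j, k).

Definition flattening3 (F : fieldType) (a b c : nat) (T : tensor F a b c)
    (phi : 'rV[F]_c) : 'M[F]_(a, b) :=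
  \matrix_(i, j) \sum_k phi 0 k * T (i, j, k).

Definition concise (F : fieldType) (a b c : nat) (T : tensor F a b c) : Prop :=
  [/\ injective (flattening1 T), injective (flattening2 T)
    & injective (flattening3 T)].

Definition compressible (F : fieldType) (a b c : nat) (a1 a2 a3 : nat)
    (T : tensor F a b c) : Prop :=
  exists (A1 : 'M[F]_a) (A2 : 'M[F]_b) (A3 : 'M[F]_c),
    [/\ \rank A1 = a1, \rank A2 = a2, \rank A3 = a3
      & tensor_act A1 A2 A3 T = 0].

(* F^m (x) F^n is identified with F^(m * n) by numbering its basis vectors
   e_i (x) e_j with mxvec_index i j. *)
Definition basis_pair (F : pzRingType) (m n : nat) (i : 'I_m) (j : 'I_n) :
    'cV[F]_(m * n) :=
  delta_mx (mxvec_index i j) 0.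

Definition matmul_tensor (F : pzRingType) (m n p : nat) :
    tensor F (m * n) (n * p) (p * m) :=
  \sum_(i < m) \sum_(j < n) \sum_(k < p)
    pure_tensor (basis_pair F i j) (basis_pair F j k) (basis_pair F k i).

(* Main.v *)
Require Import Defs.
From mathcomp Require Import all_boot all_order all_algebra.
From mathcomp Require Import reals complex ring.

Import GRing.Theory.
Local Open Scope ring_scope.

(** View a tensor in F^3 (x) F^4 (x) F^4 as a linear space of 4 x 4 matrices,
    spanned by its three slices along the first factor. The argument works over
    every field.

    Compressibility. If A1 is invertible, (A1 (x) A2 (x) A3) S = 0 says that
    every slice M satisfies A2 M A3^T = 0. Both A2 and A3 have corank 1, with
    kernels spanned by f and g^T say, and this forces M = u g + f v for some
    column u and row v ([compressible_slices]). It also bounds the rank of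
    every matrix of the space by 2.

    Degeneration. In coordinates <2,2,2> is the trilinear form tr (X Y Z) on
    2 x 2 matrices ([matmul_trilinear]). Restrict X to the 3-dimensional space
    sl_2 of traceless matrices, which is the constant first map, and substitute
    Y = y0 I + eps Y', Z = z0 I + eps Z':
<<
      tr (X Y Z) = y0 z0 tr X + eps (y0 tr (X Z') + z0 tr (X Y')) + eps^2 (..).
>>
    The constant term vanishes on sl_2. With Y' and Z' combinations of matrices
    dual to a basis of sl_2 under the trace form, the coefficient of eps is the
    form sum_i x_i (z0 y_i + y0 z_i), and linear maps of the last two factors
    send it to any S with slices u_i g + f v_i
    ([matmul_partially_degenerates]).

    No restriction. If S is concise and S = (A1 (x) A2 (x) A3) <2,2,2>, then
    the A_i have independent rows; so A2 and A3 are invertible, and the slices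
    of S span a space equivalent to the matrices X (x) I with X in a
    3-dimensional space W of 2 x 2 matrices. An invertible X in W would give
    S a matrix of rank 4, above the bound 2. Hence det vanishes on W; but det is
    a nondegenerate quadratic form in four variables, whose isotropic subspaces
    have dimension at most 2 ([rank_singular_space]). *)

(** * Slices of a tensor along its first factor *)

Section Slices.

Context {F : comNzRingType}.

Definition slice {a b c : nat} (T : tensor F a b c) (i : 'I_a) : 'M[F]_(b, c) :=
  \matrix_(j, k) T (i, j, k).

(** This is [flattening1], over rings as well: the degeneration is computed over
    polynomials. *)
Definition contract1 {a b c : nat} (T : tensor F a b c) (x : 'rV[F]_a) :
    'M[F]_(b, c) :=
  \sum_i x 0 i *: slice T i.

Lemma tensor_actE {a b c a' b' c'} (A : 'M[F]_(a', a)) (B : 'M[F]_(b', b))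
    (C : 'M[F]_(c', c)) (T : tensor F a b c) i j k :
  tensor_act A B C T (i, j, k) = \sum_i' \sum_j' \sum_k'
    T (i', j', k') * (A i i' * B j j' * C k k').
Proof.
rewrite /tensor_act sum_ffunE; apply: eq_bigr => i' _.
rewrite sum_ffunE; apply: eq_bigr => j' _.
by rewrite sum_ffunE; apply: eq_bigr => k' _; rewrite ffunE.
Qed.

Lemma slice_tensor_act {a b c a' b' c'} (A : 'M[F]_(a', a)) (B : 'M[F]_(b', b))
    (C : 'M[F]_(c', c)) (T : tensor F a b c) i :
  slice (tensor_act A B C T) i = B *m contract1 T (row i A) *m C^T.
Proof.
apply/matrixP => j k; rewrite mxE tensor_actE /contract1.
rewrite mulmx_sumr mulmx_suml summxE; apply: eq_bigr => i' _.
rewrite -scalemxAr -scalemxAl !mxE mulr_sumr exchange_big /=.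
apply: eq_bigr => k' _; rewrite !mxE mulr_suml mulr_sumr.
by apply: eq_bigr => j' _; rewrite !mxE; ring.
Qed.

Lemma contract1_tensor_act {a b c a' b' c'} (A : 'M[F]_(a', a))
    (B : 'M[F]_(b', b)) (C : 'M[F]_(c', c)) (T : tensor F a b c) x :
  contract1 (tensor_act A B C T) x = B *m contract1 T (x *m A) *m C^T.
Proof.
rewrite {1}/contract1.
under eq_bigr => i _ do rewrite slice_tensor_act scalemxAl scalemxAr.
rewrite -mulmx_suml -mulmx_sumr; congr (_ *m _ *m _).
rewrite /contract1; under eq_bigr do rewrite scaler_sumr.
rewrite exchange_big; apply: eq_bigr => i' _.
rewrite mxE scaler_suml; apply: eq_bigr => i _.
by rewrite mxE scalerA.
Qed.

End Slices.

Lemma contract1_flattening {F : fieldType} {a b c} (T : tensor F a b c) x :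
  contract1 T x = flattening1 T x.
Proof.
apply/matrixP => j k; rewrite /contract1 summxE mxE.
by apply: eq_bigr => i _; rewrite !mxE.
Qed.

Lemma contract1_tensor_polyC {F : fieldType} {a b c} (T : tensor F a b c) x :
  contract1 (tensor_polyC T) (map_mx polyC x) = map_mx polyC (contract1 T x).
Proof.
apply/matrixP => j k; rewrite /contract1 mxE !summxE raddf_sum.
by apply: eq_bigr => i _; rewrite !mxE ffunE -polyCM.
Qed.

(** * Conciseness constrains the maps of a restriction *)

Section Conciseness.

Context {F : fieldType} {a b c a' b' c' : nat}.
Context (A : 'M[F]_(a', a)) (B : 'M[F]_(b', b)) (C : 'M[F]_(c', c)).
Context (T : tensor F a b c).

Lemma flattening2_tensor_act y :
  flattening2 (tensor_act A B C T) y = A *m flattening2 T (y *m B) *m C^T.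
Proof.
apply/matrixP => i k; rewrite !mxE.
under eq_bigr => j _ do rewrite tensor_actE mulr_sumr.
rewrite exchange_big /=.
under [RHS]eq_bigr => k' _ do rewrite !mxE mulr_suml.
rewrite [RHS]exchange_big; apply: eq_bigr => i' _ /=.
under eq_bigr => j _ do rewrite mulr_sumr.
under eq_bigr => j _ do under eq_bigr => j' _ do rewrite mulr_sumr.
under eq_bigr => j _ do rewrite exchange_big.
rewrite exchange_big; apply: eq_bigr => k' _ /=.
rewrite mxE mulr_sumr mulr_suml exchange_big; apply: eq_bigr => j' _ /=.
rewrite mxE !mulr_suml mulr_sumr mulr_suml.
by apply: eq_bigr => j _; ring.
Qed.

Lemma flattening3_tensor_act z :
  flattening3 (tensor_act A B C T) z = A *m flattening3 T (z *m C) *m B^T.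
Proof.
apply/matrixP => i j; rewrite !mxE.
under eq_bigr => k _ do rewrite tensor_actE mulr_sumr.
rewrite exchange_big /=.
under [RHS]eq_bigr => j' _ do rewrite !mxE mulr_suml.
rewrite [RHS]exchange_big; apply: eq_bigr => i' _ /=.
under eq_bigr => k _ do rewrite mulr_sumr.
under eq_bigr => k _ do under eq_bigr => j' _ do rewrite mulr_sumr.
rewrite exchange_big; apply: eq_bigr => j' _ /=.
rewrite mxE mulr_sumr mulr_suml exchange_big; apply: eq_bigr => k' _ /=.
rewrite mxE !mulr_suml mulr_sumr mulr_suml.
by apply: eq_bigr => k _; ring.
Qed.

(** A form killed by one of the three maps is killed by the corresponding
    flattening of the image tensor. *)
Lemma concise_tensor_act_row_free :
  concise (tensor_act A B C T) -> [/\ row_free A, row_free B & row_free C].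
Proof.
case=> inj1 inj2 inj3; split; apply: inj_row_free => v v0.
- apply: inj1; rewrite -!contract1_flattening !contract1_tensor_act.
  by rewrite v0 mul0mx.
- by apply: inj2; rewrite !flattening2_tensor_act v0 mul0mx.
- by apply: inj3; rewrite !flattening3_tensor_act v0 mul0mx.
Qed.

End Conciseness.

(** * Matrix multiplication as the trilinear form tr (X Y Z) *)

Lemma mxvec_mul_tr {F : comNzRingType} {m n} (A B : 'M[F]_(m, n)) :
  mxvec A *m (mxvec B)^T = (\tr (A *m B^T))%:M.
Proof.
apply/matrixP => i j; rewrite !ord1 !mxE eqxx mulr1n.
rewrite (reindex _ (curry_mxvec_bij _ _)) /mxtrace.
under [RHS]eq_bigr do rewrite mxE.
rewrite pair_bigA; apply: eq_bigr => [[i' j']] _ /=.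
by rewrite !mxE !mxvecE.
Qed.

Lemma contract1_matmul {F : comNzRingType} (m n p : nat) (x : 'rV[F]_(m * n)) :
  contract1 (matmul_tensor F m n p) x =
  \sum_(i < m) \sum_(j < n) \sum_(k < p)
    x 0 (mxvec_index i j) *: delta_mx (mxvec_index j k) (mxvec_index k i).
Proof.
apply/matrixP => r s; rewrite /contract1 summxE.
under eq_bigr => t _ do rewrite !mxE /matmul_tensor sum_ffunE mulr_sumr.
rewrite exchange_big summxE; apply: eq_bigr => i _ /=.
under eq_bigr => t _ do rewrite sum_ffunE mulr_sumr.
rewrite exchange_big summxE; apply: eq_bigr => j _ /=.
under eq_bigr => t _ do rewrite sum_ffunE mulr_sumr.
rewrite exchange_big summxE; apply: eq_bigr => k _ /=.
rewrite (bigD1 (mxvec_index i j)) //= big1 => [|t /negPf tij].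
  by rewrite ffunE /basis_pair !mxE !eqxx !andbT mul1r -natrM mulnb addr0.
by rewrite ffunE /basis_pair !mxE tij !mul0r mulr0.
Qed.

(** Contracting with X in the first factor leaves the map Y |-> X Y, up to the
    transposition that turns F^p (x) F^m into m x p matrices. *)
Lemma mul_contract1_matmul {F : comNzRingType} {m n p : nat}
    (X : 'M[F]_(m, n)) (Y : 'M[F]_(n, p)) :
  mxvec Y *m contract1 (matmul_tensor F m n p) (mxvec X) = mxvec (X *m Y)^T.
Proof.
rewrite contract1_matmul.
rewrite [in RHS](matrix_sum_delta (X *m Y)^T) [RHS]linear_sum.
under [RHS]eq_bigr do rewrite linear_sum.
rewrite [RHS]exchange_big mulmx_sumr /=; apply: eq_bigr => i _.
under [RHS]eq_bigr => k _ do
  rewrite linearZ /= mxvec_delta !mxE scaler_suml.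
rewrite [RHS]exchange_big mulmx_sumr; apply: eq_bigr => j _ /=.
rewrite mulmx_sumr; apply: eq_bigr => k _.
rewrite mxvecE -scalemxAr; apply/rowP => s; rewrite !mxE.
rewrite (bigD1 (mxvec_index j k)) //= mxvecE big1 => [|t /negPf tjk].
  by rewrite !mxE !eqxx addr0 mulrA.
by rewrite !mxE tjk mulr0.
Qed.

Lemma matmul_trilinear {F : comNzRingType} {m n p : nat}
    (X : 'M[F]_(m, n)) (Y : 'M[F]_(n, p)) (Z : 'M[F]_(p, m)) :
  mxvec Y *m contract1 (matmul_tensor F m n p) (mxvec X) *m (mxvec Z)^T =
  (\tr (X *m Y *m Z))%:M.
Proof.
rewrite mul_contract1_matmul mxvec_mul_tr -trmx_mul mxtrace_tr.
by rewrite mxtrace_mulC.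
Qed.

Lemma contract1_matmul_row_free {F : fieldType} {n p : nat} (X : 'M[F]_n) :
  X \in unitmx -> row_free (contract1 (matmul_tensor F n n p) (mxvec X)).
Proof.
move=> Xu; apply: inj_row_free => y.
rewrite -{1}(vec_mxK y) mul_contract1_matmul => /(canRL mxvecK) XY0.
apply: (can_inj vec_mxK); apply: (can_inj (mulKmx Xu)); apply: trmx_inj.
by rewrite XY0 !linear0.
Qed.

(** * Linear spaces of singular 2 x 2 matrices *)

(** Sylvester's rank inequality, applied to both products. *)
Lemma rank_bilinear_vanish {F : fieldType} {n p q r : nat} (A : 'M[F]_(p, n))
    (M : 'M[F]_(n, q)) (B : 'M[F]_(r, q)) :
  A *m M *m B^T = 0 -> (\rank A + \rank M + \rank B <= n + q)%N.
Proof.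
move=> AMB0; have AM := mxrank_mul_min A M.
have := mxrank_mul_min (A *m M) B^T.
rewrite AMB0 mxrank0 leqn0 subn_eq0 mxrank_tr => AMB.
rewrite leq_subLR in AM.
by apply: leq_trans (leq_add AM (leqnn _)) _; rewrite -addnA leq_add2l.
Qed.

Lemma det2 {F : comNzRingType} (X : 'M[F]_2) :
  \det X = X 0 0 * X 1 1 - X 0 1 * X 1 0.
Proof.
rewrite (expand_det_row _ 0) big_ord_recl big_ord1 /cofactor !det_mx11 !mxE /=.
rewrite expr0 expr1 mul1r mulN1r mulrN.
by congr (X _ _ * X _ _ - X _ _ * X _ _); apply: val_inj.
Qed.

(** Conjugating by the quarter turn yields the cofactor matrix:
    rot Y rot^T = (adj Y)^T for 2 x 2 matrices Y. *)
Definition rot (F : fieldType) : 'M[F]_2 := delta_mx 0 1 - delta_mx 1 0.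

Lemma rot_sqr (F : fieldType) : rot F *m rot F = - 1%:M.
Proof.
rewrite /rot; apply/matrixP => i j; rewrite !mxE !big_ord_recl big_ord0.
by case: i => [[|[|//]] ?]; case: j => [[|[|//]] ?]; rewrite !mxE /=; ring.
Qed.

(** Both sides are the polar form of the determinant, since the left-hand side
    is tr (X adj Y). *)
Lemma tr_rot {F : fieldType} (X Y : 'M[F]_2) :
  \tr (X *m (rot F *m Y *m (rot F)^T)^T) =
  \det (X + Y) - \det X - \det Y.
Proof.
have one_lift : 1 = lift ord0 ord0 :> 'I_2 by apply: val_inj.
rewrite !det2 one_lift /mxtrace !big_ord_recl big_ord0 /rot.
do ![rewrite !mxE ?big_ord_recl ?big_ord0].
by rewrite /=; ring.
Qed.

(** The Gram matrix of the polar form of the determinant in the coordinates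
    given by [mxvec]. *)
Definition rot_mx (F : fieldType) : 'M[F]_(2 * 2) :=
  lin_mulmx (rot F) *m lin_mulmxr (rot F)^T.

Lemma mxvec_rot_mx {F : fieldType} (Y : 'M[F]_2) :
  mxvec Y *m rot_mx F = mxvec (rot F *m Y *m (rot F)^T).
Proof. by rewrite /rot_mx mulmxA !mul_vec_lin. Qed.

Lemma rank_rot_mx (F : fieldType) : \rank (rot_mx F) = 4.
Proof.
have [rot_unit _] : rot F \in unitmx /\ - rot F \in unitmx.
  by apply: mulmx1_unit; rewrite mulmxN rot_sqr opprK.
have rotT_unit : (rot F)^T \in unitmx by rewrite unitmx_tr.
apply/eqP; apply: inj_row_free => y.
rewrite -{1}(vec_mxK y) mxvec_rot_mx => /(canRL mxvecK) ryr0.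
apply: (can_inj vec_mxK); apply: (can_inj (mulKmx rot_unit)).
by apply: (can_inj (mulmxK rotT_unit)); rewrite ryr0 !linear0 mul0mx.
Qed.

(** The polar form of det vanishes on a space of singular matrices, by
    polarization, and a nondegenerate bilinear form in four variables has no
    totally isotropic space of dimension above 2. *)
Lemma rank_singular_space {F : fieldType} {k : nat} (A : 'M[F]_(k, 2 * 2)) :
  (forall x : 'rV_k, vec_mx (x *m A) \notin unitmx) -> (\rank A <= 2)%N.
Proof.
move=> sing.
have det0 x : \det (vec_mx (x *m A)) = 0.
  by apply/eqP; have := sing x; rewrite unitmxE unitfE negbK.
have ArotA : A *m (rot_mx F)^T *m A^T = 0.
  apply/matrixP => i j.
  have -> : (A *m (rot_mx F)^T *m A^T) i j =
            (row i A *m (row j A *m rot_mx F)^T) 0 0.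
    by rewrite (trmx_mul (row j A)) tr_row mulmxA -row_mul colE
               mulmxA -row_mul -colE !mxE.
  rewrite -(vec_mxK (row i A)) -(vec_mxK (row j A)) mxvec_rot_mx mxvec_mul_tr.
  rewrite tr_rot -linearD !rowE -mulmxDl !det0 !subr0 !mxE.
  by rewrite mul0rn.
have := rank_bilinear_vanish _ _ _ ArotA.
rewrite mxrank_tr rank_rot_mx addnAC -[X in (_ <= X)%N]/(2 + 2 + 4)%N.
by rewrite leq_add2r !addnn leq_double.
Qed.

(** * Compressible tensors *)

(** The left kernel is a line, and c spans it. *)
Lemma corank1_left_kernel {F : fieldType} {m n : nat} (A : 'M[F]_(m.+1, n)) :
  \rank A = m -> exists c : 'rV[F]_m.+1,
    forall k (N : 'M[F]_(k, m.+1)), N *m A = 0 -> exists w, N = w *m c.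
Proof.
move=> rkA; exists (nz_row (kermx A)) => k N /sub_kermxP NK.
have kc : (kermx A <= nz_row (kermx A))%MS.
  rewrite -(geq_leqif (mxrank_leqif_sup (nz_row_sub _))).
  by rewrite rank_rV nz_row_eq0 -mxrank_eq0 mxrank_ker rkA subSnn.
by case/submxP: (submx_trans NK kc) => w ->; exists w.
Qed.

(** If A M B = 0, then A M = w g for the row g spanning the left kernel of B;
    subtracting u g with A u g = A M leaves a matrix whose columns lie in
    ker A, the span of f. *)
Lemma corank1_annihilated {F : fieldType} {m n p q : nat}
    (A : 'M[F]_(p, m.+1)) (B : 'M[F]_(n.+1, q)) :
  \rank A = m -> \rank B = n ->
  exists (f : 'cV[F]_m.+1) (g : 'rV[F]_n.+1), forall M, A *m M *m B = 0 ->
    exists uv : 'cV[F]_m.+1 * 'rV[F]_n.+1, M = uv.1 *m g + f *m uv.2.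
Proof.
rewrite -(mxrank_tr A) => /corank1_left_kernel[f kerf].
case/corank1_left_kernel=> g kerg; exists f^T, g => M /kerg[w AMw].
(* A pseudo-inverse avoids showing that w lies in the image of A: the product
   A M is fixed by A *m pinvmx A in any case. *)
pose u := pinvmx A *m w.
have Au : A *m (u *m g) = A *m M.
  by rewrite /u -mulmxA -AMw mulmxA (mulmxA (A *m pinvmx A)) mulmxKpV.
case: (kerf _ (M - u *m g)^T) => [|v Mv].
  by rewrite -trmx_mul mulmxBr Au subrr trmx0.
exists (u, v^T); rewrite /= -trmx_mul -Mv trmxK.
by rewrite addrC subrK.
Qed.

(** A compression map of full rank on the first factor can be inverted, so the
    other two compress every single slice. *)
Lemma compressible_slices {F : fieldType} {a b c : nat}
    (S : tensor F a b.+1 c.+1) :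
  compressible a b c S ->
  exists (f : 'cV[F]_b.+1) (g : 'rV[F]_c.+1)
         (U : 'M[F]_(b.+1, a)) (V : 'M[F]_(a, c.+1)),
    forall i, slice S i = col i U *m g + f *m row i V.
Proof.
case=> A [B] [C] [rkA rkB rkC S0].
rewrite -(mxrank_tr C) in rkC.
have [f [g fg]] := corank1_annihilated _ _ rkB rkC.
have Au : A \in unitmx by rewrite -row_free_unit /row_free rkA.
have /fin_all_exists[uv Suv] i : exists uv : 'cV[F]_b.+1 * 'rV[F]_c.+1,
    slice S i = uv.1 *m g + f *m uv.2.
  apply: fg.
  have -> : slice S i = contract1 S (delta_mx 0 i *m invmx A *m A).
    rewrite mulmxKV // /contract1 (bigD1 i) //= mxE !eqxx scale1r.
    rewrite big1 ?addr0 // => j /negPf ji.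
    by rewrite mxE ji scale0r.
  rewrite -contract1_tensor_act S0 /contract1 big1 // => j _.
  by apply/matrixP => k l; rewrite !mxE ffunE mulr0.
exists f, g, (\matrix_(j, i) (uv i).1 j 0), (\matrix_i (uv i).2) => i.
rewrite Suv rowK; congr (_ *m _ + _).
by apply/colP => j; rewrite !mxE.
Qed.

(** * The degeneration *)

Definition sl2_basis (F : fieldType) (i : 'I_3) : 'M[F]_2 :=
  nth 0 [:: delta_mx 0 1; delta_mx 1 0; delta_mx 0 0 - delta_mx 1 1] i.

(** The dual of sl_2 under the trace form is the quotient of 2 x 2 matrices by
    the scalars. The representative E_11 of the last functional, rather than
    half of E_11 - E_22, works in characteristic 2 too. *)
Definition sl2_dual (F : fieldType) (i : 'I_3) : 'M[F]_2 :=
  nth 0 [:: delta_mx 1 0; delta_mx 0 1; delta_mx 0 0] i.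

Lemma tr_sl2_basis (F : fieldType) i : \tr (sl2_basis F i) = 0.
Proof.
case: i => [[|[|[|//]]] ?]; rewrite /mxtrace !big_ord_recl big_ord0 !mxE /=;
  ring.
Qed.

Lemma tr_sl2_dual (F : fieldType) i j :
  \tr (sl2_basis F i *m sl2_dual F j) = (i == j)%:R.
Proof.
case: i => [[|[|[|//]]] ?]; case: j => [[|[|[|//]]] ?];
  rewrite /mxtrace !big_ord_recl big_ord0;
  do ![rewrite !mxE ?big_ord_recl ?big_ord0]; rewrite /=; ring.
Qed.

(** First-order expansion of tr (X Y Z) at Y = Z = 1 with X traceless. *)
Theorem matmul_partially_degenerates {F : fieldType} {b c : nat}
    (S : tensor F 3 b c) (f : 'cV[F]_b) (g : 'rV[F]_c)
    (U : 'M[F]_(b, 3)) (V : 'M[F]_(3, c)) :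
  (forall i, slice S i = col i U *m g + f *m row i V) ->
  partially_degenerates_to (matmul_tensor F 2 2 2) S.
Proof.
move=> sliceS.
pose A : 'M[F]_(3, 2 * 2) := \matrix_i mxvec (sl2_basis F i).
pose D : 'M[F]_(3, 2 * 2) := \matrix_i mxvec (sl2_dual F i).
pose t : 'rV[F]_(2 * 2) := mxvec 1%:M.
pose M i := contract1 (matmul_tensor F 2 2 2) (row i A).
have tMt i : t *m M i *m t^T = 0.
  by rewrite /M rowK matmul_trilinear !mulmx1 tr_sl2_basis raddf0.
have DMt i : D *m M i *m t^T = col i 1%:M.
  apply/row_matrixP => j; rewrite !row_mul /M !rowK matmul_trilinear mulmx1.
  by rewrite tr_sl2_dual; apply/rowP => k; rewrite !ord1 !mxE eqxx eq_sym.
have tMD i : t *m M i *m D^T = row i 1%:M.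
  apply: trmx_inj; apply/row_matrixP => j.
  rewrite trmx_mul trmxK row_mul -[row j D]trmxK -trmx_mul /M !rowK.
  rewrite matmul_trilinear mulmx1 tr_sl2_dual; apply/rowP => k.
  by rewrite !ord1 !mxE eqxx.
(* A row y of the target pulls back under B to (y f) 1 + epsilon Y', where Y'
   is the combination of the dual matrices with coefficients y U; C does the
   same with g and V. *)
pose B : 'M[{poly F}]_(b, 2 * 2) :=
  map_mx polyC (f *m t) + 'X *: map_mx polyC (U *m D).
pose C : 'M[{poly F}]_(c, 2 * 2) :=
  map_mx polyC (g^T *m t) + 'X *: map_mx polyC (V^T *m D).
exists A, B, C, 1, 1.
exists (fun _ => [ffun x => (U *m D *m M x.1.1 *m D^T *m V) x.1.2 x.2]).
have BMC i : B *m map_mx polyC (M i) *m C^T =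
    'X *: map_mx polyC (slice S i) +
    'X^2 *: map_mx polyC (U *m D *m M i *m D^T *m V).
  rewrite /B /C linearD linearZ /= !map_trmx !trmx_mul !trmxK.
  rewrite !mulmxDl !mulmxDr -!scalemxAl -!scalemxAr -!map_mxM !mulmxA.
  have -> : f *m t *m M i *m t^T *m g = 0.
    by rewrite -!(mulmxA f) tMt mul0mx mulmx0.
  have -> : f *m t *m M i *m D^T *m V = f *m row i V.
    by rewrite -!(mulmxA f) tMD -row_mul mul1mx.
  have -> : U *m D *m M i *m t^T *m g = col i U *m g.
    by rewrite -2!(mulmxA U) DMt colE mul1mx -colE.
  rewrite raddf0 add0r scalerA -expr2 addrA -scalerDr sliceS.
  by rewrite [col i U *m g + _]addrC map_mxD.
apply/ffunP => [[[i j] k]]; rewrite ffunE big_ord1 ffunE /=.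
transitivity ((B *m map_mx polyC (M i) *m C^T) j k).
  rewrite -contract1_tensor_polyC map_row -slice_tensor_act.
  by rewrite mxE.
by rewrite BMC !mxE expr1.
Qed.

(** * Obstruction to restriction *)

Theorem matmul_not_restricts {F : fieldType} (S : tensor F 3 4 4) :
  concise S -> compressible 3 3 3 S ->
  ~ restricts_to (matmul_tensor F 2 2 2) S.
Proof.
move=> Sconc [B1] [B2] [B3] [rk1 rk2 rk3 S0] [A1] [A2] [A3] defS.
have B1u : B1 \in unitmx by rewrite -row_free_unit /row_free rk1.
move: Sconc; rewrite {}defS in S0 *.
case/concise_tensor_act_row_free => /eqP rkA1 freeA2 freeA3.
suff : (\rank A1 <= 2)%N by rewrite rkA1.
apply: rank_singular_space => x; apply/negP => /contract1_matmul_row_free.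
move=> /(_ 2); rewrite vec_mxK => /eqP rkN.
(* An invertible X gives a matrix of rank 4 that is annihilated by two maps of
   rank 3 on 4-dimensional spaces, and 3 + 4 + 3 > 4 + 4. *)
have := rank_bilinear_vanish (B2 *m A2)
  (contract1 (matmul_tensor F 2 2 2) (x *m A1)) (B3 *m A3).
rewrite rkN !mxrankMfree // rk2 rk3 => rk_le.
suff /rk_le : B2 *m A2 *m contract1 (matmul_tensor F 2 2 2) (x *m A1)
    *m (B3 *m A3)^T = 0 by [].
rewrite trmx_mul mulmxA -2!(mulmxA B2) -contract1_tensor_act.
rewrite -[x](mulmxKV B1u) -contract1_tensor_act S0 /contract1 big1 // => i _.
by apply/matrixP => j k; rewrite !mxE ffunE mulr0.
Qed.

(** * Honest partial degenerations of <2,2,2> *)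

Theorem proposition3p7 (R : realType) (S : tensor R[i] 3 4 4)
    (S_concise : concise S) (S_compressible : compressible 3 3 3 S) :
  honest_partial_degeneration (matmul_tensor R[i] 2 2 2) S.
Proof.
split; last exact: matmul_not_restricts.
have [f [g [U [V sliceS]]]] := compressible_slices S S_compressible.
exact: matmul_partially_degenerates sliceS.
Qed.
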